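(* Let $Q(x,y)=a_1x^2+b_1xy+c_1y^2$ be a positive definite binary quadratic form with $a_1,b_1,c_1\in\mathbb{Z}$, and let $\mathcal{A}_Q=\{n\in\mathbb{N}: Q(x,y)=n \text{ for some } x,y\in\mathbb{Z}\}$. Let $\alpha$ be an irrational number. Then for every fixed $\varepsilon>0$ there are infinitely many integers $n\in\mathcal{A}_Q$ such that $$\|\alpha n\|<n^{-1/2+\varepsilon}.$$
   Context: $\|z\|$ denotes the distance from the real number $z$ to the nearest integer. *)

(* Defs.v *)
From mathcomp Require Export all_boot all_order all_algebra.
From mathcomp Require Export all_classical all_reals all_analysis.

Set Implicit Arguments.
Unset Strict Implicit.
Unset Printing Implicit Defensive.

Import Order.TTheory GRing.Theory Num.Theory.
Local Open Scope classical_set_scope.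
Local Open Scope ring_scope.

Definition qform (K : comNzRingType) (a b c x y : K) : K :=
  a * x ^+ 2 + b * x * y + c * y ^+ 2.

Definition posdef_qform (R : realType) (a b c : int) : Prop :=
  forall x y : R, (x, y) != (0, 0) ->
    0 < qform a%:~R b%:~R c%:~R x y.

(* Here the natural numbers start at 1, so 0 = Q(0, 0) is left out. *)
Definition represented (a b c : int) : set nat :=
  [set n | (0 < n)%N /\ exists x y : int, qform a b c x y = n%:Z].

Definition dist_int (R : realType) (z : R) : R :=
  inf [set `|z - m%:~R| | m in [set: int]].

(* Main.v *)
Require Import Defs.
From mathcomp Require Import zify ring lra.
From mathcomp.real_closed Require Import complex.

Import Order.TTheory GRing.Theory Num.Theory.
Import numFieldNormedType.Exports ComplexField.Normc.
Local Open Scope classical_set_scope.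
Local Open Scope ring_scope.

Set Implicit Arguments.
Unset Strict Implicit.
Unset Printing Implicit Defensive.

(** Put D = 4ac - b^2. Since Q(x - b y, 2 a y) = a (x^2 + D y^2), it suffices to make
    beta (x^2 + D y^2) close to an integer, where beta = a alpha. With e(t) = exp(2 pi i t)
    and G(h) = sum_(x <= X) e(h beta x^2), the sum of e(h beta (x^2 + D y^2)) over x, y <= X is
    G(h) G(D h), so all the exponential sums that occur are controlled by
    sum_(h <= N) |G(h)|^2. Weyl differencing bounds this by N X + sum_(h,u) 1/||2 beta h u||,
    and by the divisor bound the double sum is at most q^o(1) times sum_(m <= N X) 1/||2 beta m||,
    which is O(q log q) when 2 beta has a reduced rational approximation with denominator
    q >= 2 N X and error at most 1/q^2. Taking X slightly larger than sqrt q and N slightly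
    smaller makes the total smaller than X^2.

    Fractional parts are detected by the kernel |(1/H) sum_(i < H) e(i t)|^(2k), a large power
    of the Fejer kernel: it is nonnegative, its constant Fourier coefficient c_0 is the largest
    one and at least 1/(k H + 1), and it is at most (H d)^(-2k) where ||t|| >= d. Hence d may be
    taken as small as H^(-1+o(1)). *)

Local Notation Re := complex.Re.

(** * The divisor bound: n has O(n^(1/B)) divisors for every B *)

Section DivisorBound.
Local Open Scope nat_scope.

(** The product (e + 1)(e + 2)...(e + B) is at least (e + 1)^B and equals B! times the binomial
    coefficient of e + B over B, which is at most 2^(e + B). *)
Lemma exp_succ_le B e : e.+1 ^ B <= B`! * 2 ^ B * 2 ^ e.
Proof.
have ffact_ge n m : m <= n -> (n - m).+1 ^ m <= n ^_ m.
  elim: m n => [|m IH] [|n] //= ltmn; rewrite ffactnS expnS subSS leq_mul//=.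
    by rewrite ltnS leq_subr.
  exact: IH.
have := ffact_ge (e + B) B (leq_addl _ _); rewrite addnK => /leq_trans; apply.
rewrite -bin_ffact mulnC -mulnA leq_mul2l -expnD addnC; apply/orP; right.
rewrite -[2]/(1 + 1) expnDn.
have BleBe : B < (B + e).+1 by rewrite ltnS leq_addr.
rewrite (bigD1 (Ordinal BleBe)) //= !exp1n !muln1 leq_addr//.
Qed.

(** A divisor d is p^i times a divisor of m, where p^i = gcd(d, p^e); this leaves e + 1 choices for
    i. *)
Lemma size_divisors_pfactorM p e m : prime p -> 0 < m ->
  size (divisors (p ^ e * m)) <= e.+1 * size (divisors m).
Proof.
move=> p_pr m_gt0.
have pe_gt0 : 0 < p ^ e by rewrite expn_gt0 prime_gt0.
rewrite -{1}(size_iota 0 e.+1) -(size_allpairs (fun i d => p ^ i * d)).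
apply: uniq_leq_size; first exact: divisors_uniq.
move=> d; rewrite -dvdn_divisors ?muln_gt0 ?pe_gt0// => d_dvd.
have d_gt0 : 0 < d by apply: dvdn_gt0 d_dvd; rewrite muln_gt0 pe_gt0.
have : gcdn d (p ^ e) %| p ^ e by exact: dvdn_gcdr.
case/(dvdn_pfactor _ _ p_pr) => i le_ie def_g.
have i_in : i \in iota 0 e.+1 by rewrite mem_iota.
apply/allpairsP; exists (i, d %/ p ^ i); split => //=.
- rewrite -dvdn_divisors// -def_g -(@dvdn_pmul2l (gcdn d (p ^ e))).
    rewrite mulnC divnK ?dvdn_gcdl// muln_gcdl dvdn_gcd dvdn_mulr//=.
  by rewrite gcdn_gt0 d_gt0.
- by rewrite mulnC divnK// -def_g dvdn_gcdl.
Qed.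

Lemma expn_monol B m n : m <= n -> m ^ B <= n ^ B.
Proof. by case: B => [|B] le_mn; rewrite ?expn0// leq_exp2r. Qed.

(** Induction splits off one full prime power p^e of n, which costs (e + 1)^B <= 2^(e B) <= p^e
    because p >= 2^B. *)
Lemma size_divisors_exp_le_rough B n : 0 < n ->
  (forall p, prime p -> p %| n -> 2 ^ B <= p) -> size (divisors n) ^ B <= n.
Proof.
elim/ltn_ind: n => n IH n_gt0 n_rough.
have [n_gt1|] := ltnP 1 n; last first.
  by case: n n_gt0 {IH n_rough} => [|[]] // _ _; rewrite exp1n.
have p_pr := pdiv_prime n_gt1; set p := pdiv n in p_pr.
have p_dvd : p %| n by exact: pdiv_dvd.
have [m pNm def_n] := pfactor_coprime p_pr n_gt0; set e := logn p n in def_n.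
have e_gt0 : 0 < e by rewrite logn_gt0 mem_primes p_pr n_gt0.
have m_gt0 : 0 < m by move: n_gt0; rewrite {1}def_n muln_gt0 => /andP[].
have m_dvd : m %| n by rewrite def_n dvdn_mulr.
have m_lt : m < n.
  rewrite def_n ltn_Pmulr// (leq_trans (prime_gt1 p_pr))//.
  by rewrite -{1}(expn1 p) (leq_pexp2l (prime_gt0 p_pr) e_gt0).
have IHm : size (divisors m) ^ B <= m.
  by apply: IH => // r r_pr r_dvd; apply: n_rough => //; apply: dvdn_trans m_dvd.
have := size_divisors_pfactorM e p_pr m_gt0.
rewrite mulnC -def_n => /(expn_monol B) /leq_trans; apply.
rewrite expnMn def_n mulnC leq_mul// (leq_trans (expn_monol B (ltn_expl e _ : _ <= 2 ^ e)))//.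
by rewrite -expnM mulnC expnM expn_monol// n_rough.
Qed.

(* Primes below 2 ^ B are treated one at a time, from the largest down: each costs a factor B! 2^B. *)
Lemma size_divisors_exp_le B :
  exists2 C, 0 < C & forall n, 0 < n -> size (divisors n) ^ B <= C * n.
Proof.
pose K := B`! * 2 ^ B.
have K_gt0 : 0 < K by rewrite muln_gt0 fact_gt0 expn_gt0.
suff main j : j <= 2 ^ B -> forall n, 0 < n ->
    (forall p, prime p -> p %| n -> 2 ^ B - j <= p) ->
    size (divisors n) ^ B <= K ^ j * n.
  exists (K ^ (2 ^ B)); first by rewrite expn_gt0 K_gt0.
  by move=> n n_gt0; apply: main => // p _ _; rewrite subnn.
elim: j => [|j IH] j_le n n_gt0 n_rough.
  by rewrite mul1n size_divisors_exp_le_rough// => p p_pr /(n_rough _ p_pr); rewrite subn0.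
pose p := 2 ^ B - j.+1.
have le_p r : p <= r -> r != p -> 2 ^ B - j <= r by rewrite /p; lia.
have [/andP[p_pr p_dvd]|pN] := boolP (prime p && (p %| n)); last first.
  rewrite (leq_trans (IH (ltnW j_le) n n_gt0 _)) ?leq_mul// ?leq_pexp2l//.
  move=> r r_pr r_dvd; apply: le_p; first exact: n_rough.
  by apply: contraNneq pN => <-; rewrite r_pr.
have [m pNm def_n] := pfactor_coprime p_pr n_gt0; set e := logn p n in def_n.
have m_gt0 : 0 < m by move: n_gt0; rewrite {1}def_n muln_gt0 => /andP[].
have m_dvd : m %| n by rewrite def_n dvdn_mulr.
have IHm : size (divisors m) ^ B <= K ^ j * m.
  apply: IH => [|//|r r_pr r_dvd]; first exact: ltnW.
  apply: le_p; first by apply: n_rough => //; apply: dvdn_trans m_dvd.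
  by apply: contraTneq r_dvd => ->; rewrite -prime_coprime.
have := size_divisors_pfactorM e p_pr m_gt0.
rewrite mulnC -def_n => /(expn_monol B) /leq_trans; apply.
rewrite expnMn def_n expnS (mulnC m) mulnACA leq_mul//.
by rewrite (leq_trans (exp_succ_le B e))// leq_mul// expn_monol// prime_gt1.
Qed.

End DivisorBound.

(** * Harmonic sums and sums over products *)

Lemma harmonic_pow2_le (R : realFieldType) j :
  \sum_(1 <= i < 2 ^ j) (i%:R : R)^-1 <= j%:R.
Proof.
elim: j => [|j IH]; first by rewrite big_geq.
(* The block from 2^j to 2^(j + 1) has 2^j terms, none larger than 2^(-j). *)
rewrite (@big_cat_nat _ _ _ (2 ^ j)%N) ?expn_gt0//=; last by rewrite leq_exp2l.
rewrite -natr1 lerD//.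
rewrite (@le_trans _ _ (\sum_(2 ^ j <= i < 2 ^ j.+1) ((2 ^ j)%N%:R : R)^-1))//.
  rewrite big_nat [leRHS]big_nat; apply: ler_sum => i /andP[le_i _].
  by rewrite lef_pV2 ?ler_nat// posrE ltr0n ?expn_gt0// (leq_trans _ le_i)// expn_gt0.
by rewrite sumr_const_nat -[leLHS]mulr_natr expnS mul2n -addnn addnK mulVf.

Qed.

(** A substitute for log q = O(q^(1/B)): if 2^k <= q < 2^(k + 1), the sum is at most k + 1, and
    [exp_succ_le] bounds (k + 1)^B by a constant times 2^k. *)
Lemma harmonic_exp_le (R : realFieldType) B : exists2 C : nat, (0 < C)%N &
  forall q : nat, (0 < q)%N -> (\sum_(1 <= i < q) (i%:R : R)^-1) ^+ B <= (C * q)%N%:R.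
Proof.
exists (B`! * 2 ^ B)%N; first by rewrite muln_gt0 fact_gt0 expn_gt0.
move=> q q_gt0; have /andP[ge_q lt_q] := @trunc_log_bounds 2 q isT q_gt0.
set k := trunc_log 2 q in ge_q lt_q.
have harm_le : \sum_(1 <= i < q) (i%:R : R)^-1 <= k.+1%:R.
  apply: le_trans (harmonic_pow2_le R k.+1).
  rewrite [leRHS](@big_cat_nat _ _ _ q)//=; last exact: ltnW.
  by rewrite lerDl sumr_ge0.
rewrite (@le_trans _ _ (k.+1%:R ^+ B))//.
  by rewrite lerXn2r ?nnegrE// sumr_ge0.
rewrite -natrX ler_nat (leq_trans (exp_succ_le B k))// leq_mul//.
Qed.

Lemma ler_sum_uniq_subset (R : realFieldType) (T : eqType) (r s : seq T) (F : T -> R) :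
  uniq r -> uniq s -> {subset r <= s} -> (forall i, 0 <= F i) ->
  \sum_(i <- r) F i <= \sum_(i <- s) F i.
Proof.
move=> r_uniq s_uniq rs F_ge0.
rewrite [leRHS](bigID (mem r)) /= -[X in X <= _]addr0 lerD// ?sumr_ge0//.
rewrite -[leRHS]big_filter (perm_big [seq i <- s | i \in r])//.
rewrite uniq_perm ?filter_uniq// => i; rewrite mem_filter.
by case: (boolP (i \in r)) => // /rs ->.
Qed.

(** When the pairs are collected by m = h u, each m arises at most once for each of its divisors
    h. *)
Lemma sum_mul_le_divisors (R : realFieldType) (g : nat -> R) (H X T : nat) :
  (forall m, 0 <= g m) ->
  (forall m, (0 < m <= H * X)%N -> (size (divisors m) <= T)%N) ->
  \sum_(1 <= h < H.+1) \sum_(1 <= u < X.+1) g (h * u)%N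
    <= T%:R * \sum_(1 <= m < (H * X).+1) g m.
Proof.
move=> g_ge0 tau_le.
apply: (@le_trans _ _ (\sum_(1 <= h < H.+1) \sum_(1 <= m < (H * X).+1 | (h %| m)%N) g m)).
  rewrite big_nat [leRHS]big_nat; apply: ler_sum => h /andP[h_gt0 h_le].
  rewrite -[leLHS](big_map (muln h) predT g) -[leRHS]big_filter.
  apply: ler_sum_uniq_subset => //.
  - by rewrite map_inj_in_uniq ?iota_uniq// => u v _ _ /eqP; rewrite eqn_pmul2l// => /eqP.
  - by rewrite filter_uniq// iota_uniq.
  - move=> _ /mapP[u + ->]; rewrite mem_index_iota => /andP[u_gt0 u_le].
    by rewrite mem_filter dvdn_mulr//= mem_index_iota muln_gt0 h_gt0 u_gt0 ltnS leq_mul.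
rewrite (exchange_big_dep xpredT)//= mulr_sumr big_nat [leRHS]big_nat.
apply: ler_sum => m /andP[m_gt0 m_le].
rewrite -big_filter big_const_seq iter_addr_0 count_predT -[leLHS]mulr_natl ler_wpM2r// ler_nat.
apply: leq_trans (tau_le m _); last by rewrite m_gt0.
apply: uniq_leq_size; first by rewrite filter_uniq// iota_uniq.
by move=> h; rewrite mem_filter -dvdn_divisors// => /andP[].
Qed.

(** * Distance to the nearest integer and rational approximation *)

Lemma dist_int_le (R : realType) (z : R) (m : int) : dist_int z <= `|z - m%:~R|.
Proof. by apply: ge_inf; [exists 0 => _ [n _ <-] | exists m]. Qed.

Lemma dist_int_ge0 (R : realType) (z : R) : 0 <= dist_int z.
Proof. by apply: lb_le_inf; [exists `|z - 0%:~R|, 0 | move=> _ [n _ <-]]. Qed.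

Lemma norm_intr_ge1 (R : realType) (m : int) : m != 0 -> 1 <= `|m%:~R : R|.
Proof. by move=> m_neq0; rewrite -intr_norm ler1z; lia. Qed.

(** The infimum is attained at floor(z + 1/2): any other integer is at distance at least 1 from it,
    hence at least 1/2 from z. *)
Lemma dist_intP (R : realType) (z : R) :
  exists2 m : int, dist_int z = `|z - m%:~R| & `|z - m%:~R| <= 2^-1.
Proof.
pose m := Num.floor (z + 2^-1).
have near : `|z - m%:~R| <= 2^-1.
  by rewrite ler_norml; have := floor_le (z + 2^-1); have := floorD1_gt (z + 2^-1);
    rewrite -/m intrD; lra.
exists m => //; apply/le_anti; rewrite dist_int_le/=; apply: lb_le_inf => [|_ [n _ <-]].
  by exists `|z - 0%:~R|, 0.
have [->//|neq_mn] := eqVneq n m.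
have := @norm_intr_ge1 R (n - m); rewrite subr_eq0 => /(_ neq_mn).
have -> : (n - m)%:~R = (z - m%:~R) - (z - n%:~R) :> R by rewrite intrB; ring.
move/le_trans => /(_ _ (ler_normB _ _)); move: near.
move: `|z - m%:~R| `|z - n%:~R| => u v; lra.
Qed.

Lemma dist_int_irrational_gt0 (R : realType) (x : R) (n : nat) :
  irrational x -> (0 < n)%N -> 0 < dist_int (x * n%:R).
Proof.
move=> x_irr n_gt0; have [m -> _] := dist_intP (x * n%:R).
rewrite normr_gt0 subr_eq0; apply/negP => /eqP xn; apply: x_irr.
by apply/rationalP; exists m, n; rewrite -xn mulfK// pnatr_eq0 -lt0n.
Qed.

(** Pigeonhole: the fractional parts of 0, x, ..., Q x fall into Q boxes of length 1/Q, and q is the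
    difference of two indices that share a box. *)
Lemma dirichlet_approx (R : realType) (x : R) (Q : nat) : (0 < Q)%N ->
  exists (q : nat) (p : int), (0 < q <= Q)%N /\ `|x * q%:R - p%:~R| < Q%:R^-1.
Proof.
move=> Q_gt0; pose fr (i : nat) : R := x * i%:R - (Num.floor (x * i%:R))%:~R.
have fr_ge0 i : 0 <= fr i by rewrite subr_ge0 floor_le.
have fr_lt1 i : fr i < 1.
  by have := floorD1_gt (x * i%:R); rewrite intrD /fr; lra.
have Q_gt0' : 0 < Q%:R :> R by rewrite ltr0n.
have box_lt (i : 'I_Q.+1) : (Num.truncn (Q%:R * fr i) < Q)%N.
  rewrite -(ltr_nat R) (@le_lt_trans _ _ (Q%:R * fr i)) ?gtr_pMr//.
  by rewrite truncn_le mulr_ge0.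
pose box i := Ordinal (box_lt i).
have : ~~ injectiveb box.
  apply/negP => /injectiveP /leq_card; rewrite !card_ord ltnn//.
move=> /injectivePn[i [j neq_ij eq_box]].
wlog lt_ij : i j neq_ij eq_box / (i < j)%N.
  move=> wl; have [lt_ij|lt_ji|eq_ij] := ltngtP i j; first exact: (wl i j).
    by apply: (wl j i) => //; rewrite eq_sym.
  by move/eqP: neq_ij; case; apply/val_inj.
exists (j - i)%N, (Num.floor (x * j%:R) - Num.floor (x * i%:R)); split.
  by have := ltn_ord j; lia.
have -> : x * (j - i)%:R - (Num.floor (x * j%:R) - Num.floor (x * i%:R))%:~R = fr j - fr i.
  by rewrite natrB 1?ltnW// intrB /fr; ring.
have eq_tr : Num.truncn (Q%:R * fr i) = Num.truncn (Q%:R * fr j) by move/(congr1 val): eq_box.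
have /truncn_itv /andP[li ui] : 0 <= Q%:R * fr i by rewrite mulr_ge0.
have /truncn_itv /andP[lj uj] : 0 <= Q%:R * fr j by rewrite mulr_ge0.
rewrite -(ltr_pM2l Q_gt0') divff ?gt_eqF// -[X in X * _](ger0_norm (ltW Q_gt0')) -normrM.
by rewrite ltr_norml mulrBr; move: li ui lj uj; rewrite eq_tr -!natr1; lra.
Qed.

(** It forces large denominators in [coprime_dirichlet] and large n in the final theorem. The bound
    has the form 1/Q so that it can be set against the error in [dirichlet_approx]. *)
Lemma dist_int_mulnat_lb (R : realType) (x : R) (B : nat) : irrational x ->
  exists2 Q : nat, (0 < Q)%N & forall n, (0 < n <= B)%N -> Q%:R^-1 <= dist_int (x * n%:R).
Proof.
move=> x_irr; elim: B => [|B [Q Q_gt0 IH]]; first by exists 1%N => // -[].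
have d_gt0 := dist_int_irrational_gt0 x_irr (ltn0Sn B).
pose Q' := maxn Q (Num.truncn (dist_int (x * B.+1%:R))^-1).+1.
have Q'_gt0 : (0 < Q')%N by rewrite /Q' leq_max Q_gt0.
exists Q' => // n /andP[n_gt0]; rewrite leq_eqVlt => /orP[/eqP ->|n_le].
  rewrite -[leRHS]invrK lef_pV2 ?posrE ?invr_gt0 ?ltr0n//.
  rewrite (le_trans (ltW (truncnS_gt _)))// ler_nat leq_max leqnn orbT//.
rewrite (le_trans _ (IH n _)) ?n_gt0// lef_pV2 ?posrE ?ltr0n// ler_nat leq_max leqnn//.
Qed.

(** Dirichlet's theorem is applied with Q such that ||x n|| >= 1/Q for 0 < n <= B. Reducing the
    fraction does not increase |x q - p|, so a denominator q <= B would contradict the choice of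
    Q. *)
Lemma coprime_dirichlet (R : realType) (x : R) (B : nat) : irrational x ->
  exists (q : nat) (p : int),
    [/\ (B < q)%N, coprime q `|p| & `|x - p%:~R / q%:R| <= (q%:R ^+ 2)^-1].
Proof.
move=> x_irr; have [Q Q_gt0 Q_lb] := dist_int_mulnat_lb B x_irr.
have [q0 [p0 [/andP[q0_gt0 q0_le] approx]]] := dirichlet_approx x Q_gt0.
pose g := gcdn q0 `|p0|; have g_gt0 : (0 < g)%N by rewrite gcdn_gt0 q0_gt0.
pose q := (q0 %/ g)%N; pose p := (p0 %/ g%:Z)%Z.
have q0E : q0 = (q * g)%N by rewrite divnK// dvdn_gcdl.
have p0E : p0 = p * g%:Z by rewrite divzK// dvdzE dvdn_gcdr.
have q_gt0 : (0 < q)%N by move: q0_gt0; rewrite q0E muln_gt0 => /andP[].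
have cop : coprime q `|p|.
  have p0E' : `|p0|%N = (`|p| * g)%N by rewrite p0E abszM.
  by rewrite /coprime -(eqn_pmul2r g_gt0) mul1n muln_gcdl -q0E -p0E'.
have approx' : `|x * q%:R - p%:~R| < Q%:R^-1.
  apply: le_lt_trans approx.
  have -> : x * q0%:R - p0%:~R = (x * q%:R - p%:~R) * g%:R.
    by rewrite q0E p0E natrM intrM; ring.
  by rewrite normrM ler_peMr// normr_nat ler1n.
exists q, p; split => //.
  rewrite ltnNge; apply/negP => q_le.
  have := Q_lb q; rewrite q_gt0 => /(_ q_le).
  by move/(lt_le_trans approx'); rewrite ltNge dist_int_le.
have q_gt0' : 0 < q%:R :> R by rewrite ltr0n.
have -> : x - p%:~R / q%:R = (x * q%:R - p%:~R) / q%:R.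
  by rewrite mulrBl mulfK ?gt_eqF.
rewrite normrM normfV normr_nat expr2 invfM ler_wpM2r ?invr_ge0//.
apply: le_trans (ltW approx') _; rewrite lef_pV2 ?posrE ?ltr0n// ler_nat.
by rewrite (leq_trans _ q0_le)// q0E leq_pmulr.
Qed.

(** The residues r of p m modulo q are distinct and nonzero for 0 < m < q. Since m <= q/2, x m
    differs from p m / q by at most 1/(2 q), which is at most half the distance from p m / q to any
    integer. Hence 1/||x m|| is at most 2 q / min(r, q - r). *)
Lemma sum_inv_dist_int_le (R : realType) (x : R) (p : int) (q M : nat) :
  coprime q `|p| -> `|x - p%:~R / q%:R| <= (q%:R ^+ 2)^-1 -> (0 < q)%N -> (2 * M <= q)%N ->
  \sum_(1 <= m < M.+1) (dist_int (x * m%:R))^-1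
    <= 4 * q%:R * \sum_(1 <= i < q) (i%:R)^-1.
Proof.
move=> cop approx q_gt0 M_le.
have q_gt0' : 0 < q%:R :> R by rewrite ltr0n.
pose r (m : nat) := `|(p * m%:Z) %% q%:Z|%Z%N.
have rE m : (r m)%:Z = ((p * m%:Z) %% q%:Z)%Z by rewrite /r gez0_abs// modz_ge0//; lia.
have r_lt m : (r m < q)%N.
  by rewrite -ltz_nat rE ltz_pmod.
have r_inj m n : (m < q)%N -> (n < q)%N -> r m = r n -> m = n.
  move=> m_lt n_lt /(congr1 Posz); rewrite !rE => /eqP.
  rewrite eqz_mod_dvd -mulrBr Gauss_dvdzr; last by rewrite coprimezE.
  by rewrite -eqz_mod_dvd => /eqP; rewrite !modz_small// => -[].
have r_gt0 m : (0 < m < q)%N -> (0 < r m)%N.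
  move=> /andP[m_gt0 m_lt]; rewrite lt0n; apply/eqP => r0.
  have /r_inj : r m = r 0%N by rewrite r0 /r mulr0 mod0z.
  by move=> /(_ m_lt q_gt0) m0; rewrite m0 in m_gt0.
(* Adding both reciprocals covers the two cases for the minimum; the reflection of i to q - i then
   makes two harmonic sums, whence the constant 4. *)
pose F (i : nat) : R := 2 * q%:R * (i%:R^-1 + (q - i)%:R^-1).
apply: (@le_trans _ _ (\sum_(1 <= m < M.+1) F (r m))).
  rewrite big_nat [leRHS]big_nat; apply: ler_sum => m /andP[m_gt0 m_le].
  have m_lt : (m < q)%N by lia.
  have rm_gt0 : (0 < r m)%N by apply: r_gt0; rewrite m_gt0.
  have [n -> _] := dist_intP (x * m%:R).
  pose N := absz (p * m%:Z - n * q%:Z)%R.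
  have := divz_eq (p * m%:Z) q%:Z; rewrite -rE; set t := (_ %/ _)%Z => pmE.
  have NE : p * m%:Z - n * q%:Z = (t - n) * q%:Z + (r m)%:Z by rewrite pmE; ring.
  have N_ge : (r m <= N)%N || (q - r m <= N)%N.
    rewrite /N NE; have := r_lt m; move: (r m) (t - n) => a b a_lt.
    have [b_ge|b_lt] := lerP 0 b; [apply/orP; left | apply/orP; right]; nia.
  have N_gt0 : (0 < N)%N by have := r_lt m; lia.
  have N_gt0' : 0 < N%:R :> R by rewrite ltr0n.
  have dist_ge : N%:R / (2 * q%:R) <= `|x * m%:R - n%:~R|.
    have N_eq : N%:R / q%:R = `|(p%:~R / q%:R - x) * m%:R + (x * m%:R - n%:~R)|.
      rewrite /N pmulrn abszE intr_norm -[in LHS](ger0_norm (ltW q_gt0')) -normf_div; congr `|_|.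
      by rewrite intrB !intrM -!pmulrn; field; rewrite gt_eqF.
    have err : `|(p%:~R / q%:R - x) * m%:R| <= (2 * q%:R)^-1.
      rewrite normrM normr_nat distrC.
      apply: (@le_trans _ _ ((q%:R ^+ 2)^-1 * m%:R)); first by rewrite ler_wpM2r.
      rewrite -(ler_pM2l (_ : 0 < 2 * q%:R ^+ 2 :> R)) ?mulr_gt0 ?exprn_gt0//.
      have -> : 2 * q%:R ^+ 2 * ((q%:R ^+ 2)^-1 * m%:R) = (2 * m)%:R :> R.
        by rewrite natrM; field; rewrite gt_eqF.
      have -> : 2 * q%:R ^+ 2 * (2 * q%:R)^-1 = q%:R :> R by field; rewrite gt_eqF.
      by rewrite ler_nat; lia.
    have := ler_normD ((p%:~R / q%:R - x) * m%:R) (x * m%:R - n%:~R); rewrite -N_eq.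
    have -> : N%:R / q%:R = N%:R / (2 * q%:R) + N%:R / (2 * q%:R) :> R.
      by field; rewrite gt_eqF.
    have : (2 * q%:R)^-1 <= N%:R / (2 * q%:R) :> R.
      by rewrite ler_peMl ?ler1n// invr_ge0 mulr_ge0// ltW.
    by move: err; lra.
  apply: (@le_trans _ _ (2 * q%:R * N%:R^-1)).
    rewrite -[leRHS]invrK lef_pV2 ?posrE.
    - by rewrite invfM invrK mulrC.
    - by apply: lt_le_trans dist_ge; rewrite divr_gt0// mulr_gt0.
    - by rewrite invr_gt0 mulr_gt0 ?invr_gt0// mulr_gt0.
  rewrite ler_wpM2l ?mulr_ge0//.
  have [le_N|le_N] := orP N_ge.
    by rewrite -[leLHS]addr0 lerD ?invr_ge0// lef_pV2 ?posrE ?ltr0n// ler_nat.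
  rewrite -[leLHS]add0r lerD ?invr_ge0// lef_pV2 ?posrE ?ltr0n ?ler_nat//.
  by rewrite subn_gt0.
rewrite -[leLHS](big_map r predT F).
apply: (@le_trans _ _ (\sum_(1 <= i < q) F i)).
  apply: ler_sum_uniq_subset => [|||i].
  - rewrite map_inj_in_uniq ?iota_uniq// => m n; rewrite !mem_index_iota => m_in n_in.
    by apply: r_inj; lia.
  - exact: iota_uniq.
  - move=> _ /mapP[m + ->]; rewrite !mem_index_iota => m_in.
    by rewrite r_lt r_gt0//; lia.
  - by rewrite mulr_ge0 ?addr_ge0 ?invr_ge0 ?mulr_ge0.
rewrite -mulr_sumr big_split/= [X in _ + X]big_nat_rev/=.
have -> : \sum_(1 <= i < q) ((q - (1 + q - i.+1))%N%:R : R)^-1 = \sum_(1 <= i < q) (i%:R)^-1.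
  by apply: eq_big_nat => i /andP[_ i_lt]; congr (_%:R^-1); lia.
by rewrite -mulr2n -mulr_natr; lra.
Qed.

(** * The complex modulus and correlation sums *)

Section Modulus.
Variable R : rcfType.
Implicit Types z w : R[i].

Lemma normc_ge0 z : 0 <= normc z.
Proof. by case: z => a b; rewrite /= sqrtr_ge0. Qed.

Lemma normcX z n : normc (z ^+ n) = normc z ^+ n.
Proof. by elim: n => [|n IH]; rewrite ?expr0 ?normc1// !exprS normcM IH. Qed.

Lemma normc_real (x : R) : 0 <= x -> normc x%:C%C = x.
Proof. by move=> x_ge0; rewrite /= expr0n/= addr0 sqrtr_sqr ger0_norm. Qed.

Lemma sqr_normc_Re z : normc z ^+ 2 = Re (z * (z^*)%C).
Proof.
case: z => a b; rewrite /= sqr_sqrtr ?addr_ge0 ?sqr_ge0//.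
by rewrite mulrN opprK !expr2.
Qed.

Lemma Re_le_normc z : Re z <= normc z.
Proof.
case: z => a b /=; rewrite (le_trans (ler_norm a))// -sqrtr_sqr ler_sqrt ?lerDl ?sqr_ge0//.
by rewrite addr_ge0 ?sqr_ge0.
Qed.

Lemma normcNc z : normc (- z) = normc z.
Proof. by case: z => a b /=; rewrite !sqrrN. Qed.

Lemma ReDc z w : Re (z + w) = Re z + Re w.
Proof. by case: z w => [a b] [c d]. Qed.

Lemma ReNc z : Re (- z) = - Re z.
Proof. by case: z. Qed.

Lemma Re_sumc I (r : seq I) (P : pred I) (F : I -> R[i]) :
  Re (\sum_(i <- r | P i) F i) = \sum_(i <- r | P i) Re (F i).
Proof. by apply: (big_morph (@complex.Re R)) => // z w; rewrite ReDc. Qed.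

Lemma Re_mulrc (x : R) z : Re (x%:C%C * z) = x * Re z.
Proof. by case: z => a b /=; rewrite mul0r subr0. Qed.

(** The off-diagonal products are grouped by their lag u, and opposite lags are conjugate. The
    identity serves both Weyl differencing and the Fourier expansion of the detecting kernel. *)
Lemma sqr_normc_sum (w : nat -> R[i]) n :
  normc (\sum_(0 <= i < n) w i) ^+ 2 = \sum_(0 <= i < n) normc (w i) ^+ 2
    + 2 * \sum_(1 <= u < n) Re (\sum_(0 <= i < n - u) w (i + u)%N * ((w i)^*)%C).
Proof.
elim: n => [|n IH]; first by rewrite !big_geq// normc0 expr0n/= mulr0 addr0.
have sqrD z z' : normc (z + z') ^+ 2 = normc z ^+ 2 + normc z' ^+ 2 + 2 * Re (z' * (z^*)%C).
  rewrite !sqr_normc_Re; case: z z' => [a b] [c d] /=; ring.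
rewrite [\sum_(0 <= i < n.+1) w i]big_nat_recr// [\sum_(0 <= i < n.+1) normc _ ^+ 2]big_nat_recr// sqrD IH.
have -> : \sum_(1 <= u < n.+1) Re (\sum_(0 <= i < n.+1 - u) w (i + u)%N * ((w i)^*)%C)
  = \sum_(1 <= u < n) Re (\sum_(0 <= i < n - u) w (i + u)%N * ((w i)^*)%C)
    + Re (w n * ((\sum_(0 <= i < n) w i)^*)%C); last by rewrite /=; ring.
case: n {IH} => [|n]; first by rewrite !big_geq// conjc0 mulr0 addr0.
(* The new last term adds exactly one product to each lag u. *)
have -> : \sum_(1 <= u < n.+2) Re (\sum_(0 <= i < n.+2 - u) w (i + u)%N * ((w i)^*)%C)
  = \sum_(1 <= u < n.+2) Re (\sum_(0 <= i < n.+1 - u) w (i + u)%N * ((w i)^*)%C)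
    + \sum_(1 <= u < n.+2) Re (w n.+1 * ((w (n.+1 - u)%N)^*)%C).
  rewrite -big_split; apply: eq_big_nat => u /andP[u_gt0 u_le].
  by rewrite subSn// big_nat_recr//= ReDc subnK.
rewrite [X in X + _]big_nat_recr//= subnn [X in _ + Re X + _]big_geq// addr0; congr (_ + _).
rewrite -Re_sumc -mulr_sumr -rmorph_sum; congr (Re (_ * (_^*)%C)).
rewrite big_add1 /= big_nat_rev/=; apply: eq_big_nat => i /andP[_ i_lt].
by congr (w _); lia.
Qed.

(** Because of this cancellation, the squared modulus of a polynomial on the unit circle has the
    autocorrelations of its coefficients as Fourier coefficients. *)
Lemma correlation_monomial (x y : R) z i u : z * (z^*)%C = 1 ->
  x%:C%C * z ^+ (i + u) * ((y%:C%C * z ^+ i)^*)%C = (x * y)%:C%C * z ^+ u.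
Proof.
move=> zz1.
have -> : ((y%:C%C * z ^+ i)^*)%C = y%:C%C * ((z^*)%C) ^+ i.
  by rewrite [LHS]rmorphM rmorphXn; congr (_ * _); exact: conjc_real.
have -> : (x * y)%:C%C = x%:C%C * y%:C%C by rewrite rmorphM.
have -> : x%:C%C * z ^+ (i + u) * (y%:C%C * ((z^*)%C) ^+ i)
    = x%:C%C * y%:C%C * z ^+ u * (z ^+ i * ((z^*)%C) ^+ i) by rewrite exprD; ring.
by rewrite -exprMn zz1 expr1n mulr1.
Qed.

Lemma normc_geom_sum z n : normc z = 1 ->
  normc (\sum_(0 <= i < n) z ^+ i) * normc (z - 1) <= 2.
Proof.
move=> z1; rewrite mulrC -normcM big_mkord -subrX1 (le_trans (le_normcD _ _))//.
by rewrite normcNc normc1 normcX z1 expr1n.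
Qed.

End Modulus.

(** * The exponential e(t) and Weyl differencing of quadratic sums *)

Section CircleExponential.
Variable R : realType.
Implicit Types s t : R.

Definition ecirc t : R[i] := (cos (2 * pi * t) +i* sin (2 * pi * t))%C.

Lemma ecircD s t : ecirc (s + t) = ecirc s * ecirc t.
Proof.
by apply/eqP; rewrite eq_complex /= mulrDr cosD sinD [X in _ && (_ == X)]addrC !eqxx.
Qed.

Lemma ecirc0 : ecirc 0 = 1.
Proof. by apply/eqP; rewrite eq_complex /= mulr0 cos0 sin0 !eqxx. Qed.

Lemma normc_ecirc t : normc (ecirc t) = 1.
Proof. by rewrite /= cos2Dsin2 sqrtr1. Qed.

Lemma ecircN t : ecirc (- t) = ((ecirc t)^*)%C.
Proof. by rewrite /ecirc mulrN cosN sinN. Qed.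

Lemma ecircMn t n : ecirc (t * n%:R) = ecirc t ^+ n.
Proof.
by elim: n => [|n IH]; rewrite ?mulr0 ?ecirc0// -natr1 mulrDr mulr1 ecircD IH exprSr.
Qed.

Lemma ecirc_int (m : int) : ecirc m%:~R = 1.
Proof.
have ecirc1 : ecirc 1 = 1.
  apply/eqP; rewrite eq_complex /= mulr1 mulr_natl cos2pi sin2pi !eqxx//.
have ecirc_nat n : ecirc n%:R = 1 by rewrite -[n%:R]mul1r ecircMn ecirc1 expr1n.
case: m => n; first exact: ecirc_nat.
by rewrite NegzE intrN ecircN ecirc_nat conjc1.
Qed.

(** With y = x/2 <= pi/4, sin x = 2 sin y cos y, and sin y = y cos c for some c in [0, y]. Both
    cosines have square at least 1/2, since cos(2 c) and cos(2 y) are nonnegative. *)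
Lemma sin_ge_half (x : R) : 0 <= x <= pi / 2 -> x / 2 <= sin x.
Proof.
move=> /andP[x_ge0 x_le]; pose y := x / 2.
have y_ge0 : 0 <= y by rewrite divr_ge0.
have y_le : y <= pi / 4 by rewrite /y; move: x_le; lra.
have pi_gt0 := @pi_gt0 R.
have cosy (c : R) : 0 <= c <= pi / 4 -> 2^-1 <= cos c ^+ 2 /\ 0 <= cos c.
  move=> c_in; split; last by apply: cos_ge0_pihalf; move: c_in; lra.
  have : 0 <= cos (c *+ 2) by apply: cos_ge0_pihalf; rewrite -mulr_natl; move: c_in; lra.
  by rewrite cos_mulr2n -mulr_natl; lra.
have [c /[!in_itv]/= c_in] : exists2 c, c \in `[0, y] & sin y - sin 0 = cos c * (y - 0).
  apply: (@MVT_segment R sin cos) => //.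
  by apply: continuous_subspaceT; exact: continuous_sin.
rewrite sin0 !subr0 => siny.
have [cy2 cy0] : 2^-1 <= cos y ^+ 2 /\ 0 <= cos y by apply: cosy; rewrite y_ge0.
have [cc2 cc0] : 2^-1 <= cos c ^+ 2 /\ 0 <= cos c.
  by apply: cosy; move: c_in; lra.
have xE : x = y *+ 2 by rewrite -[RHS]mulr_natl /y; lra.
rewrite [in leRHS]xE sin_mulr2n siny -[leRHS]mulr_natl -/y.
have prod : 2^-1 <= cos y * cos c.
  rewrite -(@ler_pXn2r _ 2) ?nnegrE ?mulr_ge0// exprMn expr2.
  by apply: ler_pM.
rewrite [cos y * _]mulrA [2 * _]mulrA ler_peMl//; lra.
Qed.

(** If d is the distance from t to the nearest integer, then |e(t) - 1| = 2 sin(pi d). As d <= 1/2,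
    [sin_ge_half] gives sin(pi d) >= pi d / 2 >= d. *)
Lemma ecirc_sub1_ge t : 2 * dist_int t <= normc (ecirc t - 1).
Proof.
have [m -> d_le] := dist_intP t; set d := t - m%:~R.
have -> : ecirc t = ecirc d by rewrite /d ecircD -intrN ecirc_int mulr1.
rewrite -(@ler_pXn2r _ 2) ?nnegrE ?normc_ge0 ?mulr_ge0// sqr_normc_Re /=.
set c := cos _; set s := sin _.
have cs : c ^+ 2 + s ^+ 2 = 1 by exact: cos2Dsin2.
pose v := sin (pi * `|d|).
have cE : c = 1 - 2 * v ^+ 2.
  rewrite /c -cos_norm normrM ger0_norm; last by rewrite mulr_ge0 ?pi_ge0.
  have -> : 2 * pi * `|d| = (pi * `|d|) *+ 2 by rewrite -[RHS]mulr_natl mulrA.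
  rewrite cos_mulr2n -mulr_natl.
  by have := cos2Dsin2 (pi * `|d|); rewrite -/v; lra.
have v_ge : `|d| <= v.
  have pi2 := @pi_ge2 R; have d_ge0 := normr_ge0 d.
  have pd_ge : 2 * `|d| <= pi * `|d| by rewrite ler_wpM2r.
  apply: le_trans (sin_ge_half _); first by lra.
  by rewrite mulr_ge0 ?pi_ge0//= ler_wpM2l ?pi_ge0.
have : `|d| ^+ 2 <= v ^+ 2 by rewrite lerXn2r ?nnegrE// (le_trans _ v_ge).
have -> : (c - 1) * (c - 1) - (s - 0) * - (s - 0) = (c ^+ 2 + s ^+ 2) + 1 - 2 * c by ring.
by rewrite cs cE exprMn; lra.
Qed.

Lemma normc_ecirc_sum_le t n : 0 < dist_int t ->
  normc (\sum_(0 <= i < n) ecirc t ^+ i) <= (dist_int t)^-1.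
Proof.
move=> d_gt0; have := normc_geom_sum n (normc_ecirc t); have := ecirc_sub1_ge t.
set a := normc _; set b := normc _ => b_ge ab_le; have a_ge0 : 0 <= b by exact: normc_ge0.
rewrite -[leRHS]mul1r ler_pdivlMr//.
have : b * (2 * dist_int t) <= b * a by rewrite ler_wpM2l.
by move/le_trans => /(_ _ ab_le); lra.
Qed.

(** At b = h beta this is G(h). *)
Definition gauss_sum (b : R) (X : nat) : R[i] :=
  \sum_(0 <= x < X) ecirc (b * x.+1%:R ^+ 2).

Lemma sqr_gauss_sum_le (b : R) X :
  (forall u, (0 < u < X)%N -> 0 < dist_int (2 * b * u%:R)) ->
  normc (gauss_sum b X) ^+ 2 <=
    X%:R + 2 * \sum_(1 <= u < X) (dist_int (2 * b * u%:R))^-1.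
Proof.
move=> d_gt0; rewrite /gauss_sum sqr_normc_sum lerD//.
  rewrite (eq_bigr (fun=> 1)); last by move=> i _; rewrite normc_ecirc expr1n.
  by rewrite big_const_nat subn0 iter_addr_0.
rewrite ler_pM2l// big_nat [leRHS]big_nat; apply: ler_sum => u u_in.
apply: le_trans (Re_le_normc _) _.
(* The difference (i + 1 + u)^2 - (i + 1)^2 = u (u + 2) + 2 u i is linear in i, so each correlation
   is a geometric sum of ratio e(2 b u). *)
rewrite (eq_bigr (fun i => ecirc (b * (u * u.+2)%:R) * ecirc (2 * b * u%:R) ^+ i)).
  by rewrite -mulr_sumr normcM normc_ecirc mul1r normc_ecirc_sum_le// d_gt0.
move=> i _; rewrite -ecircMn -ecircN -!ecircD; congr ecirc.
by rewrite -!natr1 natrM natrD -(natr1 u.+1) -(natr1 u); ring.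
Qed.
End CircleExponential.

(** * Detection by a power of the Fejer kernel, and the mean square of the quadratic sums *)

Lemma fejer_power_coef (R : rcfType) (H k : nat) : (0 < H)%N ->
  exists p : nat -> R, [/\ forall i, 0 <= p i, \sum_(0 <= i < (k * H).+1) p i = 1 &
    forall z : R[i], \sum_(0 <= i < (k * H).+1) (p i)%:C%C * z ^+ i
      = (H%:R^-1 * \sum_(0 <= i < H) z ^+ i) ^+ k].
Proof.
(* The kernel is the squared modulus of [f ^+ k] on the unit circle. The degree of [f ^+ k] is at
   most k (H - 1), so the indices up to k H contain all its coefficients. *)
move=> H_gt0; pose f : {poly R} := H%:R^-1 *: \poly_(i < H) 1.
have size_f : (size f <= H)%N by rewrite (leq_trans (size_scale_leq _ _))// size_poly.
have size_fk : (size (f ^+ k) <= (k * H).+1)%N.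
  apply: leq_trans (size_poly_exp_leq _ _) _; rewrite ltnS mulnC leq_mul//.
  by rewrite (leq_trans (leq_pred _)).
exists (fun i => (f ^+ k)`_i); split.
- move=> i; elim: k i {size_fk} => [|k IH] i; first by rewrite expr0 coef1.
  rewrite exprS coefM sumr_ge0// => j _; rewrite mulr_ge0//.
  by rewrite coefZ coef_poly mulr_ge0 ?invr_ge0//; case: ifP.
- transitivity (f ^+ k).[1].
    rewrite (horner_coef_wide _ size_fk) big_mkord.
    by apply: eq_bigr => i _; rewrite expr1n mulr1.
  rewrite horner_exp hornerZ horner_poly.
  rewrite (eq_bigr (fun=> 1)); last by move=> i _; rewrite mul1r expr1n.
  by rewrite sumr_const card_ord mulVf ?expr1n// pnatr_eq0 -lt0n.
- move=> z; pose F := map_poly (real_complex R) (f ^+ k).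
  have size_F : (size F <= (k * H).+1)%N by rewrite size_map_poly.
  transitivity F.[z].
    rewrite (horner_coef_wide _ size_F) big_mkord.
    by apply: eq_bigr => i _; rewrite coef_map.
  rewrite /F rmorphXn/= horner_exp map_polyZ/= hornerZ; congr ((_ * _) ^+ _).
    by rewrite fmorphV/= rmorph_nat.
  rewrite (horner_coef_wide _ (_ : (_ <= H)%N)); last by rewrite size_map_poly size_poly.
  rewrite big_mkord; apply: eq_bigr => i _.
  by rewrite coef_map coef_poly ltn_ord /= (rmorph1 (real_complex R)) mul1r.
Qed.

Lemma normc_fejer_le (R : realType) (t : R) (H k : nat) (d : R) : (0 < H)%N -> 0 < d ->
  d <= dist_int t ->
  normc ((H%:R^-1 * \sum_(0 <= i < H) ecirc t ^+ i) ^+ k) ^+ 2 <= (H%:R * d) ^- (2 * k).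
Proof.
move=> H_gt0 d_gt0 d_le.
have H_gt0' : 0 < H%:R :> R by rewrite ltr0n.
have dt_gt0 := lt_le_trans d_gt0 d_le.
rewrite normcX -exprM mulnC -exprVn invfM lerXn2r ?nnegrE ?normc_ge0//.
  by rewrite mulr_ge0 ?invr_ge0// ltW.
have -> : H%:R^-1 = (H%:R^-1 : R)%:C%C :> R[i] by rewrite fmorphV/= rmorph_nat.
rewrite normcM normc_real ?invr_ge0// ler_wpM2l ?invr_ge0//.
by rewrite (le_trans (normc_ecirc_sum_le _ dt_gt0))// lef_pV2 ?posrE.
Qed.

(** At every t_j the kernel c_0 + 2 sum_u c_u Re e(u t_j) is at most (H d)^(-2k). Summing over j and
    dividing by c_0 gives the claim, because 0 <= c_u <= c_0 and 1/c_0 <= k H + 1. *)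
Lemma exp_sum_detect (R : realType) (I : finType) (t : I -> R) (H k : nat) (d : R) :
  (0 < H)%N -> 0 < d -> (forall j, d <= dist_int (t j)) ->
  #|I|%:R <= #|I|%:R * (k * H).+1%:R * (H%:R * d) ^- (2 * k)
    + 2 * \sum_(1 <= u < (k * H).+1) normc (\sum_j ecirc (t j) ^+ u).
Proof.
move=> H_gt0 d_gt0 d_le; have [p [p_ge0 p_sum pE]] := @fejer_power_coef R H k H_gt0.
set n := (k * H).+1 in p_sum pE *.
pose c u := \sum_(0 <= i < n - u) p (i + u)%N * p i.
have c0E : c 0%N = \sum_(0 <= i < n) p i ^+ 2.
  by rewrite /c subn0; apply: eq_bigr => i _; rewrite addn0 expr2.
have c_ge0 u : 0 <= c u by rewrite sumr_ge0// => i _; rewrite mulr_ge0.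
(* Each product in c_u is bounded by half the sum of the two squares; both sums of squares so
   obtained are parts of c_0. *)
have c_le u : (u < n)%N -> c u <= c 0%N.
  move=> u_lt; rewrite c0E.
  have sub1 : \sum_(0 <= i < n - u) p i ^+ 2 <= \sum_(0 <= i < n) p i ^+ 2.
    rewrite [leRHS](@big_cat_nat _ _ _ (n - u)) ?leq_subr//= lerDl sumr_ge0// => i _.
    exact: sqr_ge0.
  have sub2 : \sum_(0 <= i < n - u) p (i + u)%N ^+ 2 <= \sum_(0 <= i < n) p i ^+ 2.
    rewrite [leRHS](@big_cat_nat _ _ _ u) ?(ltnW u_lt)//=.
    have <- := big_addn 0 n u xpredT (fun i => p i ^+ 2).
    by rewrite add0n lerDr sumr_ge0// => i _; exact: sqr_ge0.
  have : c u <= \sum_(0 <= i < n - u) (2^-1 * p (i + u)%N ^+ 2 + 2^-1 * p i ^+ 2).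
    apply: ler_sum => i _; have := sqr_ge0 (p (i + u)%N - p i); rewrite sqrrB -mulr_natl.
    lra.
  rewrite big_split/= -!mulr_sumr; lra.
(* This is Cauchy-Schwarz for coefficients of sum 1, in the form sum_i (n p_i - 1)^2 >= 0. *)
have c0_ge : 1 <= n%:R * c 0%N.
  have : 0 <= \sum_(0 <= i < n) (n%:R * p i - 1) ^+ 2.
    by rewrite sumr_ge0// => i _; exact: sqr_ge0.
  have -> : \sum_(0 <= i < n) (n%:R * p i - 1) ^+ 2 = n%:R * (n%:R * c 0%N - 1).
    rewrite c0E (eq_bigr (fun i => n%:R ^+ 2 * p i ^+ 2 + ((- 2 * n%:R) * p i + 1))); last first.
      by move=> i _; ring.
    rewrite !big_split/= -!mulr_sumr p_sum big_const_nat subn0 iter_addr_0; ring.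
  by rewrite pmulr_rge0 ?subr_ge0// ltr0n.
have one j : c 0%N + 2 * \sum_(1 <= u < n) c u * Re (ecirc (t j) ^+ u)
    <= (H%:R * d) ^- (2 * k).
  apply: le_trans (normc_fejer_le k H_gt0 d_gt0 (d_le j)).
  rewrite -pE sqr_normc_sum c0E lerD//.
    apply: ler_sum => i _; rewrite normcM normcX normc_ecirc expr1n mulr1 normc_real//.
  rewrite ler_pM2l//; apply: ler_sum => u _.
  rewrite -Re_mulrc.
  have -> : (c u)%:C%C = \sum_(0 <= i < n - u) (p (i + u)%N * p i)%:C%C.
    exact: (raddf_sum (real_complex R)).
  rewrite mulr_suml !Re_sumc; apply: ler_sum => i _.
  by rewrite correlation_monomial// -ecircN -ecircD subrr ecirc0.
have c0_gt0 : 0 < c 0%N.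
  by rewrite lt_neqAle c_ge0 andbT eq_sym; apply: contraTneq c0_ge => ->; rewrite mulr0 ler10.
set S := \sum_(1 <= u < n) _; set E := (_ ^- _).
have total : #|I|%:R * c 0%N - 2 * (c 0%N * S) <= #|I|%:R * E.
  have : \sum_(j : I) (c 0%N + 2 * \sum_(1 <= u < n) c u * Re (ecirc (t j) ^+ u))
      <= \sum_(j : I) E by apply: ler_sum => j _; exact: one.
  rewrite big_split/= !sumr_const -mulr_sumr exchange_big/= -[c 0%N *+ _]mulr_natl -[E *+ _]mulr_natl.
  apply: le_trans; rewrite lerD2l -mulrN ler_pM2l// /S [c 0%N * _]mulr_sumr -sumrN.
  rewrite [leLHS]big_nat [leRHS]big_nat; apply: ler_sum => u /andP[_ u_lt].
  rewrite -mulr_sumr -Re_sumc.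
  set T := \sum_j _.
  have T_ge : - normc T <= Re T.
    by rewrite lerNl -ReNc -(normcNc T) Re_le_normc.
  apply: (@le_trans _ _ (- (c u * normc T))); last by rewrite -mulrN ler_wpM2l.
  by rewrite lerN2 ler_wpM2r ?normc_ge0 ?c_le.
(* A positive left side may be multiplied by n c_0 >= 1; otherwise the claim holds because the right
   side is nonnegative. *)
rewrite -lerBlDr; have [V_le0|V_gt0] := lerP (#|I|%:R - 2 * S) 0.
  by rewrite (le_trans V_le0)// !mulr_ge0// invr_ge0 exprn_ge0// mulr_ge0// ltW.
apply: (@le_trans _ _ (n%:R * c 0%N * (#|I|%:R - 2 * S))); first by rewrite ler_peMl// ltW.
have -> : n%:R * c 0%N * (#|I|%:R - 2 * S) = n%:R * (#|I|%:R * c 0%N - 2 * (c 0%N * S)) by ring.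
by rewrite [#|I|%:R * n%:R]mulrC -mulrA ler_wpM2l.
Qed.

(** The exponential sum over pairs factors as G(u) G(D u), at most half the sum of the two squared
    moduli. Both u and D u stay within 1..D k H and u -> D u is injective, so each half is at most
    half the full sum over h. *)
Lemma quadratic_values_detect (R : realType) (b : R) (D X H k : nat) (d : R) :
  (0 < D)%N -> (0 < H)%N -> 0 < d ->
  (forall x y, (0 < x <= X)%N -> (0 < y <= X)%N ->
     d <= dist_int (b * (x ^ 2 + D * y ^ 2)%N%:R)) ->
  X%:R ^+ 2 <= X%:R ^+ 2 * (k * H).+1%:R * (H%:R * d) ^- (2 * k)
    + 2 * \sum_(1 <= h < (D * (k * H)).+1) normc (gauss_sum (b * h%:R) X) ^+ 2.
Proof.
move=> D_gt0 H_gt0 d_gt0 d_le.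
pose t (j : 'I_X * 'I_X) := b * (j.1.+1 ^ 2 + D * j.2.+1 ^ 2)%N%:R.
have := @exp_sum_detect R _ t H k d H_gt0 d_gt0; rewrite card_prod card_ord natrM -expr2.
move=> /(_ _)/le_trans; apply => [j|]; first by apply: d_le => /=.
rewrite lerD2l ler_pM2l//.
pose g h := normc (gauss_sum (b * h%:R) X) ^+ 2.
have g_ge0 h : 0 <= g h by exact: sqr_ge0.
apply: (@le_trans _ _ (\sum_(1 <= u < (k * H).+1) (2^-1 * g u + 2^-1 * g (D * u)%N))).
  apply: ler_sum => u _.
  have -> : \sum_j ecirc (t j) ^+ u
      = gauss_sum (b * u%:R) X * gauss_sum (b * (D * u)%:R) X.
    rewrite /gauss_sum !big_mkord big_distrlr pair_bigA/=; apply: eq_bigr => j _.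
    rewrite -ecircMn -ecircD; congr ecirc; rewrite /t natrD [(D * _ ^ 2)%:R]natrM !natrX natrM; ring.
  rewrite normcM /g; set v := normc _; set w := normc _.
  have := sqr_ge0 (v - w); rewrite sqrrB -mulr_natl; lra.
rewrite big_split/= -!mulr_sumr.
have sub1 : \sum_(1 <= u < (k * H).+1) g u <= \sum_(1 <= h < (D * (k * H)).+1) g h.
  apply: ler_sum_uniq_subset => //; rewrite ?iota_uniq// => u.
  by rewrite !mem_index_iota => /andP[-> /leq_trans]; apply; rewrite ltnS leq_pmull.
have sub2 : \sum_(1 <= u < (k * H).+1) g (D * u)%N <= \sum_(1 <= h < (D * (k * H)).+1) g h.
  rewrite -[leLHS](big_map (muln D) predT g); apply: ler_sum_uniq_subset => //.
  - by rewrite map_inj_in_uniq ?iota_uniq// => u v _ _ /eqP; rewrite eqn_pmul2l// => /eqP.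
  - exact: iota_uniq.
  - move=> _ /mapP[u + ->]; rewrite !mem_index_iota => /andP[u_gt0 u_le].
    by rewrite muln_gt0 D_gt0 u_gt0 ltnS leq_mul.
rewrite -/g; lra.
Qed.

(** Differencing at b h gives X + 2 sum_u 1/||2 b h u||. In the double sum, grouping by m = h u
    costs T and the rational approximation costs 4 q times the harmonic sum, whence 8 = 2 * 4. *)
Lemma sum_gauss_sum_le (R : realType) (b : R) (p : int) (q N X T : nat) :
  irrational (2 * b) -> coprime q `|p| -> `|2 * b - p%:~R / q%:R| <= (q%:R ^+ 2)^-1 ->
  (0 < q)%N -> (2 * (N * X) <= q)%N ->
  (forall m, (0 < m <= q)%N -> (size (divisors m) <= T)%N) ->
  \sum_(1 <= h < N.+1) normc (gauss_sum (b * h%:R) X) ^+ 2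
    <= (N * X)%:R + 8 * T%:R * q%:R * \sum_(1 <= i < q) (i%:R)^-1.
Proof.
move=> b_irr cop approx q_gt0 NX_le tau_le.
pose g m := (dist_int (2 * b * m%:R))^-1.
have g_ge0 m : 0 <= g m by rewrite invr_ge0 dist_int_ge0.
apply: (@le_trans _ _ (\sum_(1 <= h < N.+1) (X%:R + 2 * \sum_(1 <= u < X.+1) g (h * u)%N))).
  rewrite big_nat [leRHS]big_nat; apply: ler_sum => h /andP[h_gt0 _].
  have hE u : 2 * (b * h%:R) * u%:R = 2 * b * (h * u)%:R by rewrite natrM; ring.
  apply: le_trans (sqr_gauss_sum_le _) _.
    by move=> u /andP[u_gt0 _]; rewrite hE dist_int_irrational_gt0// muln_gt0 h_gt0.
  rewrite lerD2l ler_pM2l// (eq_bigr (fun u => g (h * u)%N)); last by move=> u _; rewrite hE.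
  apply: ler_sum_uniq_subset => //; rewrite ?iota_uniq// => u.
  by rewrite !mem_index_iota => /andP[-> /leqW].
rewrite big_split/= sumr_const_nat subSS subn0 -[X%:R *+ N]mulr_natr -natrM mulnC lerD2l.
rewrite -mulr_sumr.
have tau_le' m : (0 < m <= N * X)%N -> (size (divisors m) <= T)%N.
  by move=> m_in; apply: tau_le; move: m_in NX_le; lia.
have pairs_le := sum_mul_le_divisors g_ge0 tau_le'.
have g_le := sum_inv_dist_int_le cop approx q_gt0 NX_le.
have T_ge0 : 0 <= T%:R :> R by [].
have := le_trans pairs_le (ler_wpM2l T_ge0 g_le).
set S := \sum_(1 <= i < q) _; set S' := \sum_(1 <= h < _) _.
by rewrite -!mulrA mulrCA; move: (T%:R * _) => v; lra.
Qed.

(** * Choice of scales and small values of beta (x^2 + D y^2) modulo 1 *)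

Lemma nat_root (n e : nat) : (0 < e)%N ->
  exists r, (r ^ e <= n)%N /\ (n < r.+1 ^ e)%N.
Proof.
move=> e_gt0; elim: n => [|n [r [r_le r_gt]]]; first by exists 0%N; rewrite exp0n// exp1n.
have [le_r|lt_r] := leqP (r.+1 ^ e) n.+1.
  exists r.+1; split=> //; apply: leq_trans (_ : (r.+1 ^ e).+1 <= _)%N => //.
  by rewrite ltn_exp2r.
by exists r; split=> //; apply: leqW.
Qed.

(** Since C <= C^e, the e-th root is taken without leaving the natural numbers. *)
Lemma expn_leq_root (C L n e : nat) : (0 < e)%N -> (n ^ (2 * e) <= C * L ^ e)%N ->
  (0 < C)%N -> (n ^ 2 <= C * L)%N.
Proof.
move=> e_gt0 n_le C_gt0; rewrite -(leq_exp2r _ _ e_gt0) -expnM (leq_trans n_le)// expnMn.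
by rewrite leq_mul// -{1}(expn1 C) leq_pexp2l.
Qed.

Lemma irrational_mulrn (R : realType) (x : R) (n : nat) : (0 < n)%N ->
  irrational x -> irrational (n%:R * x).
Proof.
move=> n_gt0 x_irr /rationalP[a [b xE]]; apply/x_irr/rationalP; exists a, (b * n)%N.
by rewrite natrM invfM mulrA -xE mulrAC mulfV ?mul1r// pnatr_eq0 -lt0n.
Qed.

(** Here s = floor(sqrt q) and L = floor(s^(1/A)). With kernel power A, X = s L and N = D A H, the
    choice H = floor(s / (2 D A L)) is the largest with 2 N X <= s^2. The last two bounds make the
    kernel tail at most 1/4 and compare q L^2 with X^2. *)
Lemma scale_arith (D A q s L : nat) : (0 < D)%N -> (3 < A)%N ->
  (s ^ 2 <= q)%N -> (q < s.+1 ^ 2)%N -> (L ^ A <= s)%N -> (s < L.+1 ^ A)%N ->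
  (2 * D * A <= L)%N -> (10 <= L)%N ->
  exists H, [/\ (0 < H)%N, (s <= 4 * D * A * L * H)%N, (2 * (D * (A * H) * (s * L)) <= q)%N,
    (4 * (A * H).+1 <= L ^ (2 * A))%N & (q * L ^ 2 <= 4 * (s * L) ^ 2)%N].
Proof.
move=> D_gt0 A_gt3 s_le s_gt L_le L_gt L_DA L_ge10.
have A_gt0 : (0 < A)%N by apply: leq_trans A_gt3.
have L_gt0 : (0 < L)%N by apply: leq_trans L_ge10.
have L4_le : (L ^ 4 <= s)%N by apply: leq_trans L_le; rewrite leq_pexp2l.
pose K := (2 * D * A * L)%N; pose H := (s %/ K)%N.
have K_gt0 : (0 < K)%N by rewrite /K !muln_gt0 D_gt0 A_gt0.
have K_le : (K <= s)%N.
  apply: leq_trans L4_le; apply: (@leq_trans (L * L)%N); first by rewrite /K leq_mul2r L_DA orbT.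
  by rewrite mulnn leq_pexp2l.
have s_ge10 : (10 <= s)%N.
  by apply: leq_trans L4_le; apply: leq_trans L_ge10 _; rewrite -{1}(expn1 L) leq_pexp2l.
have H_gt0 : (0 < H)%N by rewrite divn_gt0.
have HK_le : (H * K <= s)%N by exact: leq_divM.
exists H; split=> //.
- have -> : (4 * D * A * L * H = H * K + H * K)%N by rewrite /K; ring.
  rewrite [leqLHS](divn_eq s K) -/H leq_add2l.
  by apply: leq_trans (ltnW (ltn_pmod s K_gt0)) _; rewrite leq_pmull.
- apply: leq_trans s_le.
  have -> : (2 * (D * (A * H) * (s * L)) = s * (H * K))%N by rewrite /K; ring.
  by rewrite -mulnn leq_mul2l HK_le orbT.
- have AH_le : (2 * (A * H) <= s)%N.
    apply: leq_trans HK_le; have -> : (H * K = 2 * (A * H) * (D * L))%N by rewrite /K; ring.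
    by rewrite leq_pmulr// muln_gt0 D_gt0.
  have AH_lt : (4 * (A * H).+1 <= 4 * s)%N.
    by rewrite leq_mul2l/=; move: AH_le s_ge10; clear; move: (A * H)%N => n; lia.
  (* Here s < (L + 1)^A, 4 (L + 1)^A <= (4 (L + 1))^A, and 4 (L + 1) <= 10 L <= L^2. *)
  apply: leq_trans AH_lt _; apply: leq_trans (leq_mul (leqnn 4) (ltnW L_gt)) _.
  rewrite mulnC; apply: (@leq_trans ((L.+1 * 4) ^ A)%N).
    by rewrite expnMn leq_mul2l -{1}(expn1 4) leq_pexp2l// orbT.
  rewrite expnM leq_exp2r// -mulnn; apply: (@leq_trans (L * 10)%N).
    by move: L_ge10; clear; lia.
  by rewrite leq_mul2l L_ge10 orbT.
- rewrite expnMn mulnA leq_mul2r; apply/orP; right.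
  apply: leq_trans (ltnW s_gt) _; rewrite -[4%N]/(2 ^ 2)%N -expnMn leq_exp2r//.
  by move: s_ge10; clear; lia.
Qed.

(** By contradiction with d = L/H, so that H d = L. In [quadratic_values_detect] the tail is then at
    most X^2 / 4 and the quadratic sums give at most q (1 + 16 T E) <= 0.17 q L^2 <= 0.68 X^2, in
    total less than X^2. *)
Lemma small_quadratic_value_at_scale (R : realType) (b : R) (p : int) (D A q s L T : nat) (E : R) :
  irrational (2 * b) -> coprime q `|p| -> `|2 * b - p%:~R / q%:R| <= (q%:R ^+ 2)^-1 ->
  (forall m, (0 < m <= q)%N -> (size (divisors m) <= T)%N) ->
  E = \sum_(1 <= i < q) (i%:R)^-1 ->
  (0 < D)%N -> (3 < A)%N -> (s ^ 2 <= q)%N -> (q < s.+1 ^ 2)%N ->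
  (L ^ A <= s)%N -> (s < L.+1 ^ A)%N -> (2 * D * A <= L)%N -> (10 <= L)%N ->
  100 * T%:R * E <= L%:R ^+ 2 ->
  exists x y, [/\ (0 < x <= s * L)%N, (0 < y <= s * L)%N &
    dist_int (b * (x ^ 2 + D * y ^ 2)%N%:R) < 4 * D%:R * A%:R * L%:R ^+ 2 / s%:R].
Proof.
move=> b_irr cop approx tau_le EE D_gt0 A_gt3 s_le s_gt L_le L_gt L_DA L_ge10 TE_le.
have [H [H_gt0 s_le4 NX_le tail_nat q_lt_nat]] :=
  scale_arith D_gt0 A_gt3 s_le s_gt L_le L_gt L_DA L_ge10.
have L_gt0 : (0 < L)%N by exact: leq_trans L_ge10.
have s_gt0 : (0 < s)%N by apply: leq_trans L_le; rewrite expn_gt0 L_gt0.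
have q_gt0 : (0 < q)%N by apply: leq_trans s_le; rewrite expn_gt0 s_gt0.
pose X := (s * L)%N; pose d : R := L%:R / H%:R.
have H_gt0' : 0 < H%:R :> R by rewrite ltr0n.
have L_gt0' : 0 < L%:R :> R by rewrite ltr0n.
have s_gt0' : 0 < s%:R :> R by rewrite ltr0n.
have d_gt0 : 0 < d by rewrite divr_gt0.
have d_le : d <= 4 * D%:R * A%:R * L%:R ^+ 2 / s%:R.
  rewrite /d ler_pdivrMr// mulrAC ler_pdivlMr//.
  have -> : 4 * D%:R * A%:R * L%:R ^+ 2 * H%:R = L%:R * (4 * D * A * L * H)%N%:R :> R.
    by rewrite !natrM; ring.
  by rewrite ler_wpM2l// ler_nat.
apply: contrapT => none.
have far x y : (0 < x <= X)%N -> (0 < y <= X)%N ->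
    d <= dist_int (b * (x ^ 2 + D * y ^ 2)%N%:R).
  move=> x_in y_in; rewrite leNgt; apply/negP => lt_d; apply: none; exists x, y.
  by split=> //; apply: lt_le_trans d_le.
have := @quadratic_values_detect R b D X H A d D_gt0 H_gt0 d_gt0 far.
have W_le := sum_gauss_sum_le b_irr cop approx q_gt0 NX_le tau_le.
rewrite -EE -/X in W_le.
have -> : H%:R * d = L%:R by rewrite /d mulrCA mulfV ?mulr1// gt_eqF.
have tail : (A * H).+1%:R * L%:R ^- (2 * A) <= 4^-1 :> R.
  by rewrite ler_pdivrMr ?exprn_gt0// ler_pdivlMl// -natrX -natrM ler_nat.
have W_le2 : 2 * ((D * (A * H) * X)%:R + 8 * T%:R * q%:R * E) <= q%:R * (1 + 16 * (T%:R * E)) :> R.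
  have : (2 * (D * (A * H) * X))%N%:R <= q%:R :> R by rewrite ler_nat.
  by rewrite natrM; clear; lra.
have q_lt : q%:R * L%:R ^+ 2 <= 4 * X%:R ^+ 2 :> R by rewrite -!natrX -!natrM ler_nat.
have X_gt0 : 0 < X%:R ^+ 2 :> R by rewrite exprn_gt0// ltr0n muln_gt0 s_gt0.
have TE16 : 1 + 16 * (T%:R * E) <= (17 / 100) * L%:R ^+ 2.
  have : 100 <= L%:R ^+ 2 :> R by rewrite -natrX ler_nat -[100%N]/(10 ^ 2)%N leq_exp2r.
  by move: TE_le; rewrite -mulrA; move: (T%:R * E) => v; clear; lra.
have q_ge0 : 0 <= q%:R :> R by [].
have := ler_wpM2l q_ge0 TE16.
have := ler_wpM2l (ltW X_gt0) tail; rewrite [X in X <= _ -> _]mulrA.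
move: W_le W_le2 q_lt X_gt0.
set Y := X%:R ^+ 2; set U := Y * _ * _; set W := \sum_(1 <= h < _) _.
set Z := q%:R * (1 + _); set V := q%:R * L%:R ^+ 2.
have -> : q%:R * (17 / 100 * L%:R ^+ 2) = 17 / 100 * V by rewrite /V; ring.
move: ((D * _ * _)%:R + _) => M; clear; lra.
Qed.

(* The divisor function and the harmonic sum up to q are O(q^(1/(4A))) = O(sqrt L), so their product is o(L^2). *)
Lemma small_quadratic_value (R : realType) (b : R) (D A L0 : nat) :
  irrational b -> (0 < D)%N -> (3 < A)%N ->
  exists L s x y, [/\ (L0 <= L)%N, (L ^ A <= s)%N, (0 < x <= s * L)%N, (0 < y <= s * L)%N &
    dist_int (b * (x ^ 2 + D * y ^ 2)%N%:R) < 4 * D%:R * A%:R * L%:R ^+ 2 / s%:R].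
Proof.
move=> b_irr D_gt0 A_gt3; have A_gt0 : (0 < A)%N by exact: leq_trans A_gt3.
have b2_irr : irrational (2 * b) by exact: irrational_mulrn.
have [C1 C1_gt0 tau_le] := size_divisors_exp_le (4 * A).
have [C2 C2_gt0 harm_le] := @harmonic_exp_le R (4 * A).
pose c1 := (C1 * 4 ^ A.+1)%N; pose c2 := (C2 * 4 ^ A.+1)%N.
have c1_gt0 : (0 < c1)%N by rewrite muln_gt0 C1_gt0 expn_gt0.
have c2_gt0 : (0 < c2)%N by rewrite muln_gt0 C2_gt0 expn_gt0.
pose L1 := (L0 + 2 * D * A + 10 + 100 * (c1 * c2))%N.
have L1_ge : [/\ (L0 <= L1)%N, (2 * D * A <= L1)%N, (10 <= L1)%N & (100 * (c1 * c2) <= L1)%N].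
  by rewrite /L1; clear; move: (2 * D * A)%N (c1 * c2)%N => u v; split; lia.
case: L1_ge => L1_L0 L1_DA L1_10 L1_c.
(* A denominator above L1^(2 A) makes L, the integer A-th root of s = floor(sqrt q), at least L1. *)
have [q [p [q_gt cop approx]]] := coprime_dirichlet (L1 ^ (A * 2)) b2_irr.
have [s [s_le s_gt]] := @nat_root q 2 isT.
have [L [L_le L_gt]] := @nat_root s A A_gt0.
have L_ge : (L1 <= L)%N.
  rewrite -ltnS -(ltn_exp2r _ _ A_gt0); apply: leq_ltn_trans L_gt.
  by rewrite -ltnS -(@ltn_exp2r _ _ 2)// -expnM; apply: ltn_trans s_gt.
have L_L0 := leq_trans L1_L0 L_ge; have L_DA := leq_trans L1_DA L_ge.
have L_10 := leq_trans L1_10 L_ge; have L_c := leq_trans L1_c L_ge.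
have L_gt0 : (0 < L)%N by exact: leq_trans L_10.
have q_gt0 : (0 < q)%N by apply: leq_ltn_trans q_gt.
(* The chain is q <= 4 s^2 <= 4 (L + 1)^(2 A) <= 4 (2 L)^(2 A). *)
have q_le : (q <= 4 ^ A.+1 * L ^ (2 * A))%N.
  apply: (@leq_trans (4 * (s ^ 2))).
    have s_gt0 : (0 < s)%N by apply: leq_trans L_le; rewrite expn_gt0 L_gt0.
    by apply: leq_trans (ltnW s_gt) _; rewrite -[4%N]/(2 ^ 2)%N -expnMn leq_exp2r//; move: s_gt0; clear; lia.
  rewrite [(4 ^ A.+1)%N]expnS -mulnA leq_mul2l/= expnM -expnMn.
  apply: (@leq_trans ((L.+1 ^ A) ^ 2)); first by rewrite leq_exp2r// ltnW.
  by rewrite -expnM mulnC expnM leq_exp2r// -[4%N]/(2 ^ 2)%N -expnMn leq_exp2r//; move: L_gt0; clear; lia.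
have L_gt0' : 0 < L%:R :> R by rewrite ltr0n.
have [T [T_le T_gt]] := @nat_root (c1 * L) 2 isT.
have tau_T m : (0 < m <= q)%N -> (size (divisors m) <= T)%N.
  move=> /andP[m_gt0 m_le]; rewrite -ltnS -(@ltn_exp2r _ _ 2)//.
  apply: leq_ltn_trans T_gt; apply: (@expn_leq_root _ _ _ (2 * A)) => //; first by rewrite muln_gt0 A_gt0.
  rewrite mulnA; apply: leq_trans (tau_le m m_gt0) _.
  by rewrite /c1 -mulnA leq_mul2l (leq_trans m_le q_le) orbT.
pose E : R := \sum_(1 <= i < q) (i%:R)^-1.
have E_ge0 : 0 <= E by rewrite sumr_ge0.
have E2_le : E ^+ 2 <= c2%:R * L%:R.
  rewrite -(@ler_pXn2r _ (2 * A)) ?nnegrE ?mulr_ge0 ?exprn_ge0//; last by rewrite muln_gt0 A_gt0.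
  rewrite -exprM mulnA; apply: le_trans (harm_le q q_gt0) _.
  rewrite -natrM -natrX ler_nat expnMn.
  apply: (@leq_trans (c2 * L ^ (2 * A))).
    by rewrite /c2 -mulnA leq_mul2l q_le orbT.
  by rewrite leq_mul2r -{1}(expn1 c2) leq_pexp2l ?orbT// muln_gt0 A_gt0.
(* After squaring, T^2 E^2 <= c1 c2 L^2, and 100 c1 c2 <= L. *)
have TE_le : 100 * T%:R * E <= L%:R ^+ 2.
  rewrite -(@ler_pXn2r _ 2) ?nnegrE ?mulr_ge0 ?exprn_ge0//.
  rewrite !exprMn.
  have T2_le : T%:R ^+ 2 <= c1%:R * L%:R :> R by rewrite -natrX -natrM ler_nat.
  have := ler_pM (sqr_ge0 _) (sqr_ge0 _) T2_le E2_le.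
  have cL : (100 ^ 2 * (c1 * c2) <= L ^ 2)%N.
    apply: (@leq_trans ((100 * (c1 * c2)) ^ 2)); last by rewrite leq_exp2r.
    by rewrite expnMn leq_mul2l -{1}(expn1 (c1 * c2)) leq_pexp2l// muln_gt0 c1_gt0.
  have -> : c1%:R * L%:R * (c2%:R * L%:R) = (c1 * c2)%:R * L%:R ^+ 2 :> R.
    by rewrite natrM; ring.
  move=> TE; rewrite -mulrA; apply: le_trans (ler_wpM2l (sqr_ge0 _) TE) _.
  by rewrite mulrA ler_wpM2r ?sqr_ge0// -!natrX -natrM ler_nat.
have [x [y [x_in y_in d_lt]]] := small_quadratic_value_at_scale b2_irr cop approx tau_T
  (erefl E) D_gt0 A_gt3 s_le s_gt L_le L_gt L_DA L_10 TE_le.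
by exists L, s, x, y.
Qed.

(** * The quadratic form and the conclusion *)

Lemma posdef_qform_disc (R : realType) (a b c : int) : posdef_qform R a b c ->
  0 < a /\ 0 < 4 * a * c - b ^+ 2.
Proof.
move=> pos; have a_gt0 : 0 < a.
  have := pos 1 0; rewrite /qform xpair_eqE oner_eq0 => /(_ isT).
  by rewrite mulr0 expr0n/= mulr0 !addr0 expr1n mulr1 ltr0z.
split=> //; rewrite -(pmulr_rgt0 _ a_gt0) -(ltr0z R).
(* The value of the form at (-b, 2 a) is a (4 a c - b^2). *)
have := pos (- b%:~R) (2 * a%:~R); rewrite /qform xpair_eqE mulf_eq0 pnatr_eq0 /=.
rewrite intr_eq0 (gt_eqF a_gt0) andbF => /(_ isT).
rewrite [X in 0 < X](_ : _ = (a * (4 * a * c - b ^+ 2))%:~R)//.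
by rewrite expr2 [b ^+ 2]expr2 !(intrM, intrB); ring.
Qed.

Lemma qform_diagonal (a b c x y : int) :
  qform a b c (x - b * y) (2 * a * y) = a * (x ^+ 2 + (4 * a * c - b ^+ 2) * y ^+ 2).
Proof. by rewrite /qform; ring. Qed.

(** Let e be the minimum of eps and 1/4; the cap keeps -1/2 + e negative, so n may be replaced by
    its upper bound M = C (s L)^2. Then M^(1/2) <= C s L and M^e >= L^(A e) >= L^4, while B C L^3 <=
    L^4. *)
Lemma scale_le_powR (R : realType) (eps : R) (B C A L s n : nat) :
  0 < eps -> 4 <= Num.min eps 4^-1 * A%:R -> (0 < n)%N -> (n <= C * (s * L) ^ 2)%N ->
  (L ^ A <= s)%N -> (0 < L)%N -> (B * C <= L)%N ->
  B%:R * L%:R ^+ 2 / s%:R <= n%:R `^ (- 2^-1 + eps).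
Proof.
set e := Num.min _ _ => eps_gt0 eA n_gt0 n_le L_le L_gt0 BC_le.
have s_gt0 : (0 < s)%N by apply: leq_trans L_le; rewrite expn_gt0 L_gt0.
have C_gt0 : (0 < C)%N by move: (leq_trans n_gt0 n_le); rewrite muln_gt0 => /andP[].
have e_gt0 : 0 < e by rewrite lt_min eps_gt0/= invr_gt0.
have [e_eps e_4] : e <= eps /\ e <= 4^-1 by rewrite !ge_min !lexx orbT.
have L_gt0' : 0 < L%:R :> R by rewrite ltr0n.
have s_gt0' : 0 < s%:R :> R by rewrite ltr0n.
pose M : R := (C * (s * L) ^ 2)%N%:R.
have M_gt0 : 0 < M by rewrite ltr0n (leq_trans n_gt0).
apply: (@le_trans _ _ (n%:R `^ (- (2^-1 - e)))); last first.
  by rewrite ler_powR ?ler1n//; move: e_eps; clear; lra.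
apply: (@le_trans _ _ (M `^ (- (2^-1 - e)))); last first.
  have n_gt0' : 0 < n%:R :> R by rewrite ltr0n.
  rewrite !powRN lef_pV2 ?posrE ?powR_gt0//.
  by rewrite ge0_ler_powR ?nnegrE ?ler_nat//; move: e_4; clear; lra.
have sqrtM : M `^ 2^-1 <= C%:R * (s%:R * L%:R).
  rewrite powR12_sqrt ?(ltW M_gt0)//.
  rewrite -[leRHS]ger0_norm ?mulr_ge0// -sqrtr_sqr ler_sqrt ?sqr_ge0//.
  rewrite exprMn /M natrM natrX natrM ler_wpM2r ?sqr_ge0//.
  by rewrite -natrX ler_nat -{1}(expn1 C) leq_pexp2l.
have Me : L%:R ^+ 4 <= M `^ e.
  rewrite -powR_mulrn ?(ltW L_gt0')//.
  apply: (@le_trans _ _ (L%:R `^ (A%:R * e))).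
    by rewrite ler_powR ?ler1n// mulrC.
  rewrite powRrM powR_mulrn ?(ltW L_gt0')// -natrX.
  rewrite ge0_ler_powR ?nnegrE ?ler_nat ?(ltW e_gt0) ?(ltW M_gt0)//.
  apply: leq_trans L_le _; rewrite -mulnn; apply: leq_trans (leq_pmull _ C_gt0).
  apply: leq_trans (leq_pmulr _ _); first by rewrite leq_pmulr.
  by rewrite muln_gt0 s_gt0.
have Me_gt0 : 0 < M `^ e by rewrite powR_gt0.
rewrite opprB powRD; last by rewrite (gt_eqF M_gt0) implybT.
rewrite powRN ler_pdivrMr// mulrAC ler_pdivlMr ?powR_gt0//.
have BL2 : 0 <= B%:R * L%:R ^+ 2 :> R by rewrite mulr_ge0 ?sqr_ge0.
apply: le_trans (ler_wpM2l BL2 sqrtM) _.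
have -> : B%:R * L%:R ^+ 2 * (C%:R * (s%:R * L%:R)) = (B * C)%:R * L%:R ^+ 3 * s%:R :> R.
  by rewrite natrM; ring.
rewrite ler_wpM2r//; apply: le_trans Me.
by rewrite exprS ler_wpM2r ?exprn_ge0// ler_nat.
Qed.

Lemma infinite_set_nat_unbounded (S : set nat) :
  (forall N, exists2 n, S n & (N < n)%N) -> infinite_set S.
Proof.
move=> unb /finite_fsetP[F SE]; have [n Sn] := unb (\max_(i <- finmap.enum_fset F) i)%N.
rewrite ltnNge => /negP; apply; apply: leq_bigmax_seq => //.
by move: Sn; rewrite SE.
Qed.

Unset Implicit Arguments.

Theorem theorem1 (R : realType) (a1 b1 c1 : int)
    (posQ : posdef_qform R a1 b1 c1)
    (alpha : R) (irr_alpha : irrational alpha)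
    (eps : R) (eps_gt0 : 0 < eps) :
  infinite_set [set n : nat | represented a1 b1 c1 n /\
    dist_int (alpha * n%:R) < n%:R `^ (- 2^-1 + eps)].
Proof.
have [a1_gt0 D1_gt0] := posdef_qform_disc posQ.
pose a := `|a1|%N; pose D := absz (4 * a1 * c1 - b1 ^+ 2)%R.
have aE : a1 = a%:Z by rewrite gtz0_abs.
have DE : 4 * a1 * c1 - b1 ^+ 2 = D%:Z by rewrite gtz0_abs.
have a_gt0 : (0 < a)%N by rewrite absz_gt0 gt_eqF.
have D_gt0 : (0 < D)%N by rewrite absz_gt0 gt_eqF.
apply: infinite_set_nat_unbounded => N.
(* Every n in 1..N has ||alpha n|| >= 1/Q, so a value of n with smaller distance exceeds N. *)
have [Q Q_gt0 Q_lb] := dist_int_mulnat_lb N irr_alpha.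
pose e := Num.min eps 4^-1.
have e_gt0 : 0 < e by rewrite lt_min eps_gt0/= invr_gt0.
(* The size of A gives e A >= 4, and the four successors also give A > 3. *)
pose A := (Num.truncn (4 / e)).+4.
have eA : 4 <= e * A%:R.
  rewrite mulrC -ler_pdivrMr//; apply: le_trans (ltW (truncnS_gt _)) _.
  by rewrite ler_nat /A !ltnS; do 3!apply: leqW.
have irr_b : irrational (a%:R * alpha) by exact: irrational_mulrn.
(* [C] comes from n <= a (1 + D) (s L)^2, and [B] from the constant in [small_quadratic_value]. *)
pose C := (a * D.+1)%N; pose B := (4 * D * A)%N.
have A_gt3 : (3 < A)%N by [].
(* In the lower bound for L, B C serves [scale_le_powR], Q serves n > N, and 1 makes L positive. *)
have [L [s [x [y [L_ge L_le x_in y_in]]]]] :=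
  small_quadratic_value (B * C + Q + 1) irr_b D_gt0 A_gt3.
pose n := (a * (x ^ 2 + D * y ^ 2))%N.
have -> : a%:R * alpha * (x ^ 2 + D * y ^ 2)%:R = alpha * n%:R by rewrite /n natrM; ring.
have -> : 4 * D%:R * A%:R = B%:R :> R by rewrite /B !natrM.
move=> dist_lt; have L_gt0 : (0 < L)%N by apply: leq_trans L_ge; rewrite addn1.
have BC_le : (B * C <= L)%N by apply: leq_trans L_ge; rewrite -addnA leq_addr.
have Q_le : (Q <= L)%N by apply: leq_trans L_ge; rewrite addnAC leq_addl.
have n_gt0 : (0 < n)%N by rewrite muln_gt0 a_gt0 addn_gt0 expn_gt0; move: x_in => /andP[->].
have n_le : (n <= C * (s * L) ^ 2)%N.
  rewrite /n /C -mulnA leq_mul2l mulSn; apply/orP; right.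
  have [_ x_le] := andP x_in; have [_ y_le] := andP y_in.
  by apply: leq_add; rewrite ?leq_mul2l leq_exp2r ?x_le ?y_le ?orbT.
exists n; first split.
- split=> //; exists (x%:Z - b1 * y%:Z), (2 * a1 * y%:Z).
  rewrite qform_diagonal DE aE /n !(PoszM, PoszD).
  by rewrite !expr2.
- exact: lt_le_trans dist_lt (scale_le_powR eps_gt0 eA n_gt0 n_le L_le L_gt0 BC_le).
(* If n <= N, then 1/Q <= ||alpha n|| < B L^2 / s, against Q B L^2 <= L^4 <= L^A <= s. *)
rewrite ltnNge; apply/negP => n_leN.
have := Q_lb n; rewrite n_gt0 n_leN => /(_ isT) /le_lt_trans/(_ dist_lt).
apply/negP; rewrite -leNgt.
have s_gt0 : (0 < s)%N by apply: leq_trans L_le; rewrite expn_gt0 L_gt0.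
rewrite ler_pdivrMr ?ltr0n// ler_pdivlMl ?ltr0n//.
rewrite -natrX -!natrM ler_nat; apply: leq_trans L_le.
have C_gt0 : (0 < C)%N by rewrite muln_gt0 a_gt0.
have B_le : (B <= L)%N by apply: leq_trans BC_le; rewrite leq_pmulr.
apply: (@leq_trans (L ^ 4)); last by rewrite leq_pexp2l.
by rewrite [(L ^ 4)%N]expnS [(L ^ 3)%N]expnS !leq_mul.
Qed.
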